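(* Let $Q\in\mathbb{R}^{n\times n}$ be symmetric positive definite with half-bandwidth at most $\nu$, where $0\le\nu\le n-1$, let $r\in\mathbb{R}^n$, and let $W_r$ be the associated energy. Consider the layered trellis specified by the branch costs $\gamma_i$ and transition mapping $T$ defined in the context, with initial state $u_1=(0,\ldots,0)\in\{0,1\}^\nu$ for $\nu\ge1$ and $u_1=\varnothing$ for $\nu=0$. Then the length-$n$ paths beginning at $u_1$ are in one-to-one correspondence with binary patterns $z\in\{0,1\}^n$ (via their branch-label sequences). For the path labeled by $z=(z_1,\ldots,z_n)$, $$\sum_{i=1}^n\gamma_i(u_i,z_i)=W_r(z),$$ where $u_i$ denotes the state of the path at the beginning of layer $i$.
   Context: For $c\in\{0,1\}^n$, $x(c)=(1-2c_1,\ldots,1-2c_n)^{\mathsf T}$. For $r\in\mathbb{R}^n$: $y_i=0$ if $r_i\ge0$ and $y_i=1$ otherwise; $s=x(y)$; $a=r-s$; and for $z\in\{0,1\}^n$, $$W_r(z)=\sum_{i=1}^n\alpha_iz_i+\sum_{1\le i<j\le n}\beta_{ij}z_iz_j,\qquad \alpha_i=2s_i(Qa)_i+2Q_{ii},\quad \beta_{ij}=4s_is_jQ_{ij}.$$ A symmetric matrix $Q$ has half-bandwidth at most $\nu$ if $Q_{ij}=0$ whenever $|i-j|>\nu$. Trellis: the state space is $\{0,1\}^\nu$ if $\nu\ge1$ and $\{\varnothing\}$ if $\nu=0$. At each layer $i=1,\ldots,n$, from each state $u$ there is a branch for each label $b\in\{0,1\}$, leading to the successor state $T(u,b)$ and having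 cost $\gamma_i(u,b)$. For $\nu\ge1$ and $u=(u_1,\ldots,u_\nu)$ (here the subscripts index components of the state), $$\gamma_i(u,b)=\alpha_ib+\sum_{d=1}^{\min\{\nu,i-1\}}\beta_{i-d,i}\,u_{\nu-d+1}\,b,$$ $T(u,b)=(b)$ if $\nu=1$, and $T(u,b)=(u_2,\ldots,u_\nu,b)$ if $\nu\ge2$. For $\nu=0$, $\gamma_i(\varnothing,b)=\alpha_ib$ and $T(\varnothing,b)=\varnothing$. A length-$n$ path takes one branch per layer, with states satisfying $u_{i+1}=T(u_i,z_i)$, where $z_i$ is the label of the branch taken at layer $i$. *)

(* Defs.v *)
From HB Require Import structures.
From mathcomp Require Import all_boot all_order all_algebra.
From mathcomp Require Import reals.

Set Implicit Arguments.
Unset Strict Implicit.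
Unset Printing Implicit Defensive.

Import Order.TTheory GRing.Theory Num.Theory.
Local Open Scope ring_scope.

(** Indices are 0-based: the [i]-th layer or coordinate ([1 <= i <= n]) is the
    ordinal of value [i - 1], and the component [u_k] of a state
    ([1 <= k <= nu]) is entry [k - 1] of the tuple. *)

Section MatrixConditions.
Context {R : realType} {n : nat}.

Definition symmetric_mx (Q : 'M[R]_n) : Prop := Q^T = Q.

Definition positive_definite (Q : 'M[R]_n) : Prop :=
  forall x : 'cV[R]_n, x != 0 -> 0 < (x^T *m Q *m x) 0 0.

Definition half_bandwidth_le (nu : nat) (Q : 'M[R]_n) : Prop :=
  forall i j : 'I_n, (nu < `|i - j|)%N -> Q i j = 0.

End MatrixConditions.

Section Energy.
Context {R : realType} {n : nat}.

Definition sign_vec (c : n.-tuple bool) : 'cV[R]_n :=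
  \col_i (1 - 2 * (tnth c i)%:R).

Definition hard_decision (r : 'cV[R]_n) : n.-tuple bool :=
  [tuple ~~ (0 <= r i 0) | i < n].

Definition hard_sign (r : 'cV[R]_n) : 'cV[R]_n := sign_vec (hard_decision r).

Definition residual (r : 'cV[R]_n) : 'cV[R]_n := r - hard_sign r.

Definition alpha (Q : 'M[R]_n) (r : 'cV[R]_n) (i : 'I_n) : R :=
  2 * hard_sign r i 0 * (Q *m residual r) i 0 + 2 * Q i i.

Definition beta (Q : 'M[R]_n) (r : 'cV[R]_n) (i j : 'I_n) : R :=
  4 * hard_sign r i 0 * hard_sign r j 0 * Q i j.

Definition energy (Q : 'M[R]_n) (r : 'cV[R]_n) (z : n.-tuple bool) : R :=
  \sum_(i < n) alpha Q r i * (tnth z i)%:R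
  + \sum_(i < n) \sum_(j < n | (i < j)%N)
      beta Q r i j * (tnth z i)%:R * (tnth z j)%:R.

End Energy.

(** For [nu = 0] the only state is the empty tuple. *)
Definition trellis_state (nu : nat) := nu.-tuple bool.

Definition zero_state (nu : nat) : trellis_state nu := [tuple of nseq nu false].

(** Shift register: append [b], then drop the oldest bit.  This gives [(b)] for
    [nu = 1], [(u_2, ..., u_nu, b)] for [nu >= 2], and the empty state for
    [nu = 0], where the bit dropped is [b] itself. *)
Definition transition (nu : nat) (u : trellis_state nu) (b : bool) :
    trellis_state nu :=
  [tuple of behead (rcons u b)].

Definition ord_subn (n : nat) (i : 'I_n) (d : nat) : 'I_n :=
  Ordinal (leq_ltn_trans (leq_subr d i) (ltn_ord i)).

(** In the sum, [1 <= d <= minn nu i]: [ord_subn i d] is thus never truncated,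
    and entry [nu - d], i.e. component [u_(nu - d + 1)], lies within [u].
    For [nu = 0] the sum is empty. *)
Definition branch_cost {R : realType} {n nu : nat} (Q : 'M[R]_n)
    (r : 'cV[R]_n) (i : 'I_n) (u : trellis_state nu) (b : bool) : R :=
  alpha Q r i * b%:R
  + \sum_(1 <= d < (minn nu i).+1)
      beta Q r (ord_subn i d) i * (nth false u (nu - d))%:R * b%:R.

(** [p.1] lists the [n + 1] states visited, the last one being reached after
    layer [n]; [p.2] lists the labels of the [n] branches taken. *)
Definition is_trellis_path (n nu : nat) (u1 : trellis_state nu)
    (p : n.+1.-tuple (trellis_state nu) * n.-tuple bool) : bool :=
  (tnth p.1 ord0 == u1) &&
  [forall i : 'I_n, tnth p.1 (lift ord0 i)
     == transition (tnth p.1 (widen_ord (leqnSn n) i)) (tnth p.2 i)].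

Definition trellis_path (n nu : nat) (u1 : trellis_state nu) :=
  {p : n.+1.-tuple (trellis_state nu) * n.-tuple bool | is_trellis_path u1 p}.

Definition path_labels (n nu : nat) (u1 : trellis_state nu)
    (p : trellis_path n u1) : n.-tuple bool := (val p).2.

(** The state at the beginning of layer [i]. *)
Definition path_state (n nu : nat) (u1 : trellis_state nu)
    (p : trellis_path n u1) (i : 'I_n) : trellis_state nu :=
  tnth (val p).1 (widen_ord (leqnSn n) i).

(* Main.v *)
Require Import Defs.
From HB Require Import structures.
From mathcomp Require Import all_boot all_order all_algebra.
From mathcomp Require Import reals.

Set Implicit Arguments.
Unset Strict Implicit.
Unset Printing Implicit Defensive.

Import Order.TTheory GRing.Theory Num.Theory.
Local Open Scope ring_scope.

(** A path is determined by its labels, its state before layer [i] holding the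
    last [nu] labels read, so that [branch_cost] charges the interactions of [z_i]
    with the labels at distance at most [nu] before it. The bandwidth of [Q] makes
    all other interactions vanish, so each pair [i < j] of the energy is counted
    exactly once, at layer [j]. *)

Section Trellis.
Context {n nu : nat}.
Implicit Types (u : trellis_state nu) (z : n.-tuple bool).

(** Each transition appends one bit and drops the oldest, so the drops can all be postponed to the
    end. *)
Lemma val_foldl_transition u (s : seq bool) :
  foldl (@transition nu) u s = drop (size s) (u ++ s) :> seq bool.
Proof.
elim: s u => [|b s IHs] u /=; first by rewrite cats0 drop0.
(* [rcons u b] has a head even when [nu = 0]; the case analysis exposes it, so that [behead]
   computes. *)
by rewrite IHs -cat_rcons; case: u => -[|c t] ?.
Qed.

Lemma nth_foldl_transition u (s : seq bool) (d : nat) :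
  (0 < d)%N -> (d <= nu)%N -> (d <= size s)%N ->
  nth false (foldl (@transition nu) u s) (nu - d) = nth false s (size s - d).
Proof.
move=> d_gt0 le_d_nu le_d_s.
rewrite val_foldl_transition nth_drop nth_cat size_tuple addnBA //.
(* The index in [u ++ s] is [nu + (size s - d)], which lies past [u]. *)
by rewrite ltnNge addnC -addnBA // leq_addr /= addKn.
Qed.

Lemma path_state_foldl u1 (p : trellis_path n u1) (i : 'I_n.+1) :
  tnth (val p).1 i = foldl (@transition nu) u1 (take i (path_labels p)).
Proof.
case: p => -[us z] pathP; rewrite /path_labels /=.
have /andP[/eqP us0 /forallP usS] := pathP.
case: i => i; elim: i => [|i IHi] lt_i_n.
  by rewrite take0 /= -us0; congr tnth; apply: val_inj.
have lt_i : (i < n)%N := lt_i_n.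
have /eqP := usS (Ordinal lt_i); rewrite /= in us0 *.
rewrite (_ : lift _ _ = Ordinal lt_i_n); last exact: val_inj.
rewrite (_ : widen_ord _ _ = Ordinal (ltnW lt_i_n)); last exact: val_inj.
move=> ->; rewrite IHi /= (take_nth false) ?size_tuple // foldl_rcons.
by rewrite (tnth_nth false).
Qed.

(** Running the register on the prefixes of [z] supplies the inverse of [path_labels]. *)
Lemma run_is_trellis_path u1 z :
  is_trellis_path u1
    ([tuple foldl (@transition nu) u1 (take i z) | i < n.+1], z).
Proof.
apply/andP; split; first by rewrite tnth_mktuple take0.
apply/forallP => i; rewrite !tnth_mktuple lift0 /= (take_nth false) ?size_tuple //.
by rewrite foldl_rcons (tnth_nth false).
Qed.

Lemma path_labels_bij u1 : bijective (@path_labels n nu u1).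
Proof.
exists (fun z => Sub _ (run_is_trellis_path u1 z)) => // p.
apply: val_inj; rewrite /= [RHS]surjective_pairing; congr (_, _).
by apply: eq_from_tnth => i; rewrite tnth_mktuple path_state_foldl.
Qed.

End Trellis.

Lemma big_ord_subn (V : nmodType) (n : nat) (i : 'I_n) (F : 'I_n -> V) :
  \sum_(1 <= d < i.+1) F (ord_subn i d) = \sum_(j < n | (j < i)%N) F j.
Proof.
rewrite big_add1 big_mkord (big_ord_narrow (ltnW (ltn_ord i))).
(* With offsets shifted to start at 0, [d] stands for [d.+1], and [i - d.+1] is the reversal of
   ['I_i]. *)
rewrite [RHS](reindex_inj rev_ord_inj) /=.
by apply: eq_bigr => d _; congr F; apply: val_inj.
Qed.

Section BandedEnergy.
Context {R : realType} {n nu : nat} (Q : 'M[R]_n) (r : 'cV[R]_n).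

Lemma beta_eq0 (Q_banded : half_bandwidth_le nu Q) (i j : 'I_n) :
  (nu < `|i - j|)%N -> beta Q r i j = 0.
Proof. by move=> /Q_banded Qij0; rewrite /beta Qij0 mulr0. Qed.

Lemma banded_energyE (Q_banded : half_bandwidth_le nu Q) (z : n.-tuple bool) :
  energy Q r z =
  \sum_(i < n) (alpha Q r i * (tnth z i)%:R
    + \sum_(1 <= d < (minn nu i).+1)
        beta Q r (ord_subn i d) i * (tnth z (ord_subn i d))%:R * (tnth z i)%:R).
Proof.
rewrite /energy big_split /=; congr (_ + _).
(* Each pair is now grouped under its larger index, here [i]. *)
rewrite (exchange_big_dep predT) //=; apply: eq_bigr => i _.
rewrite -(big_ord_subn i (fun j => beta Q r j i * (tnth z j)%:R * (tnth z i)%:R)).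
rewrite (@big_cat_nat _ _ _ (minn nu i).+1) //= ?ltnS ?geq_minr //.
rewrite [X in _ + X]big_nat [X in _ + X]big1 ?addr0 // => d.
rewrite gtn_min !ltnS => /andP[lt_d le_d_i].
(* The tail beyond [minn nu i] has [d <= i], so it can only exceed [nu]: it lies outside the
   band. *)
have lt_nu_d : (nu < d)%N by case/orP: lt_d => //; rewrite ltnNge le_d_i.
rewrite (beta_eq0 Q_banded) ?mul0r //=.
by rewrite distnC distnEl ?leq_subr // subKn.
Qed.

(** Since [d] is at most both [nu] and [i], entry [nu - d] of the state is a label already read, [d]
    layers back, and never a bit of [u1]. *)
Lemma branch_cost_path (u1 : trellis_state nu) (p : trellis_path n u1)
    (i : 'I_n) (b : bool) :
  branch_cost Q r i (path_state p i) b =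
  alpha Q r i * b%:R
    + \sum_(1 <= d < (minn nu i).+1)
        beta Q r (ord_subn i d) i
          * (tnth (path_labels p) (ord_subn i d))%:R * b%:R.
Proof.
rewrite /branch_cost; congr (_ + _); apply: eq_big_nat => d.
rewrite ltnS leq_min => /and3P[d_gt0 le_d_nu le_d_i].
have size_take_i : size (take i (path_labels p)) = i.
  by rewrite size_takel // size_tuple ltnW.
rewrite /path_state path_state_foldl nth_foldl_transition ?size_take_i //=.
rewrite nth_take ?(tnth_nth false) //=.
(* Position [i - d] falls inside the prefix of length [i] because [0 < d <= i]. *)
by rewrite ltn_subrL d_gt0 (leq_trans d_gt0).
Qed.

End BandedEnergy.

Theorem theoremV2 (R : realType) (n nu : nat) (Q : 'M[R]_n) (r : 'cV[R]_n)
    (hnu : (nu < n)%N)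
    (hsym : symmetric_mx Q)
    (hpd : positive_definite Q)
    (hbw : half_bandwidth_le nu Q) :
  bijective (fun p : trellis_path n (zero_state nu) => path_labels p) /\
  forall (z : n.-tuple bool) (p : trellis_path n (zero_state nu)),
    path_labels p = z ->
    \sum_(i < n) branch_cost Q r i (path_state p i) (tnth z i) = energy Q r z.
Proof.
split; first exact: path_labels_bij.
move=> z p <-; rewrite (banded_energyE _ hbw).
by apply: eq_bigr => i _; rewrite branch_cost_path.
Qed.
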